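(* Let $M\ge 1$ be an integer and let $1<r\le M+1$ be a real number. For (Lebesgue) almost all $q\in(1,r)$ there exist arbitrarily large integers $m$ such that the word $\beta_1(q)\cdots\beta_m(q)$ ends with more than $\log_r m$ consecutive zero digits.
   Context: For a real base $q>1$, an expansion of a real number $x$ in base $q$ is a sequence $(c_i)\in\{0,1,\ldots,M\}^\infty$ with $\sum_{i=1}^\infty c_i q^{-i}=x$. For $q\in(1,M+1]$, $\beta(q)=(\beta_i(q))_{i\ge1}$ denotes the lexicographically largest expansion (the greedy expansion) of $x=1$ in base $q$ over the alphabet $\{0,\ldots,M\}$. *)

(* Defs.v *)
From HB Require Import structures.
From mathcomp Require Import all_boot all_order all_algebra.
From mathcomp Require Import all_classical all_reals all_analysis.
From mathcomp Require Import ring.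
Set Implicit Arguments.
Unset Strict Implicit.
Unset Printing Implicit Defensive.
Import Order.TTheory GRing.Theory Num.Theory.
Import numFieldNormedType.Exports.
Local Open Scope classical_set_scope.
Local Open Scope ring_scope.

(* Digit sequences are indexed from 0: [c i] is the digit of index [i + 1],
   hence of weight [q ^- i.+1]. *)
Definition is_expansion (R : realType) (M : nat) (q x : R)
    (c : nat -> 'I_M.+1) : Prop :=
  series (fun i => (c i)%:R * q ^- i.+1) @ \oo --> x.

Definition lex_lt (M : nat) (c d : nat -> 'I_M.+1) : Prop :=
  exists n, (forall i, (i < n)%N -> c i = d i) /\ (c n < d n)%N.

Definition is_greedy_expansion (R : realType) (M : nat) (q x : R)
    (b : nat -> 'I_M.+1) : Prop :=
  is_expansion q x b /\
  forall c : nat -> 'I_M.+1, is_expansion q x c -> c = b \/ lex_lt c b.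

(* The default value is irrelevant for 1 < q <= M + 1; see [betaP]. *)
Definition beta (R : realType) (M : nat) (q : R) : nat -> 'I_M.+1 :=
  xget (fun=> ord0) [set b : nat -> 'I_M.+1 | is_greedy_expansion q 1 b].

Definition logb (R : realType) (r x : R) : R := ln x / ln r.

Section beta_exists.
Variables (R : realType) (M : nat) (q : R).
Hypotheses (q1 : 1 < q) (qM : q <= M%:R + 1).

Let dig (x : R) : 'I_M.+1 := inord (minn M (Num.truncn (q * x))).
Let rem (n : nat) : R := iter n (fun x => q * x - (dig x)%:R) 1.
Let g (n : nat) : 'I_M.+1 := dig (rem n).

Let q0 : 0 < q. Proof. exact: lt_trans q1. Qed.

Let digE x : dig x = minn M (Num.truncn (q * x)) :> nat.
Proof. by rewrite inordK // ltnS geq_minl. Qed.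

Let rem_bound n : 0 <= rem n <= M%:R / (q - 1).
Proof.
have q10 : 0 < q - 1 by rewrite subr_gt0.
have B1 : 1 <= M%:R / (q - 1) by rewrite ler_pdivlMr// mul1r lerBlDr.
elim: n => [|n /andP[r0 rB]]; first by rewrite /= ler01.
rewrite /rem iterS -/(rem n) digE.
have qr0 : 0 <= q * rem n by rewrite mulr_ge0// ltW.
have /andP[t1 t2] := truncn_itv qr0.
have [Mt|tM] := leqP M (Num.truncn (q * rem n)).
  apply/andP; split.
    by rewrite subr_ge0 (le_trans _ t1)// ler_nat.
  have -> : M%:R / (q - 1) = q * (M%:R / (q - 1)) - M%:R :> R.
    by field; rewrite gt_eqF.
  by rewrite lerD2r ler_pM2l.
rewrite subr_ge0 t1/= (le_trans _ B1)// lerBlDr addrC natr1.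
exact: ltW.
Qed.

Let sum_g n : series (fun i => (g i)%:R * q ^- i.+1) n = 1 - rem n * q ^- n.
Proof.
have qn0 : q != 0 by rewrite gt_eqF.
elim: n => [|n IH]; first by rewrite /series/= big_geq// expr0 invr1 mulr1 subrr.
rewrite seriesSr IH /rem iterS -/(rem n) -/(g n) exprS.
by field; rewrite qn0 expf_neq0.
Qed.

Let g_expansion : is_expansion q 1 g.
Proof.
have qi : `|q^-1| < 1 by rewrite ger0_norm ?invr_ge0 ?invf_lt1// ltW.
rewrite /is_expansion (_ : series _ = (fun n => 1 - rem n * q ^- n)); last first.
  by apply/funext => n; rewrite sum_g.
rewrite -[X in _ --> X]subr0; apply: cvgB; first exact: cvg_cst.
apply: (@squeeze_cvgr _ _ _ _ (cst 0) (geometric (M%:R / (q - 1)) q^-1)).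
- near=> n; have /andP[a b] := rem_bound n.
  have qn : 0 <= q ^- n by rewrite invr_ge0 exprn_ge0// ltW.
  by rewrite mulr_ge0//= exprVn ler_wpM2r.
- exact: cvg_cst.
- exact: cvg_geometric.
Unshelve. all: by end_near.
Qed.

Let g_largest c : is_expansion q 1 c -> c = g \/ lex_lt c g.
Proof.
move=> cE; have [|cg] := pselect (c = g); [by left|right].
have ex : exists n, c n != g n.
  apply: contrapT => /forallNP h; apply: cg; apply/funext => n.
  by apply/eqP/negPn/negP/h.
case: (ex_minnP ex) => n cgn nmin.
have eqn i : (i < n)%N -> c i = g i.
  by move=> ni; apply/eqP; apply: contraTT ni => /nmin; rewrite -leqNgt.
exists n; split=> //; rewrite ltnNge; apply/negP => gc.
have {}gc : (g n < c n)%N by rewrite ltn_neqAle gc eq_sym andbT.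
have qr0 : 0 <= q * rem n.
  by apply: mulr_ge0; [exact: ltW|case/andP: (rem_bound n)].
have lt1 : q * rem n < (c n)%:R.
  move: gc; rewrite /g digE gtn_min => /orP[|tc].
    by rewrite ltnNge -ltnS ltn_ord.
  by have /andP[_ t2] := truncn_itv qr0; rewrite (lt_le_trans t2)// ler_nat.
pose S := series (fun i => (c i)%:R * q ^- i.+1).
have nS : nondecreasing_seq S.
  apply: nondecreasing_series => i _ _.
  by rewrite mulr_ge0// invr_ge0 exprn_ge0// ltW.
have cS : cvgn S by apply/cvg_ex; exists 1.
have := nondecreasing_cvgn_le nS cS n.+1.
rewrite (cvg_lim (@Rhausdorff R) cE) {nS cS}/S.
rewrite seriesSr (_ : series _ n = 1 - rem n * q ^- n); last first.
  by rewrite -sum_g; apply: eq_big_nat => i /= /eqn ->.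
apply/negP; rewrite -ltNge.
have -> : rem n * q ^- n = q * rem n * q ^- n.+1.
  by rewrite exprS; field; rewrite expf_neq0 gt_eqF.
rewrite -addrA ltrDl addrC subr_gt0 ltr_pM2r// invr_gt0.
exact: exprn_gt0.
Qed.

Lemma betaP : is_greedy_expansion q 1 (beta M q).
Proof. by apply: (xgetPex (fun=> ord0 : 'I_M.+1)); exists g. Qed.

End beta_exists.

(* Main.v *)
(* Let [x_n(q)] be the n-th remainder of the greedy expansion of 1, so that
   [x_0 = 1] and [x_{n+1}] is the fractional part of [q x_n].  As a function of
   [q], each [x_n] with [n >= 1] is piecewise polynomial: on every piece [u, v)
   it is nondecreasing, convex, vanishes at [u] and is at most 1 at [v]
   (multiplication by [q] preserves convexity of a nonnegative nondecreasing
   function, and the piece is cut where [q x_n] crosses an integer).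
   The next [k] digits vanish on [{q ^ k x_n(q) < 1}], which by convexity fills
   at least the proportion [b ^- k] of a piece contained in [1, b).  These
   conditional bounds multiply: the bases [q < b] for which none of [L]
   consecutive blocks of [k] digits vanishes have measure at most
   [(1 - b ^- k) ^ L * (b - 1)].  If [b < r], then [L] can be taken so large
   that [L / b ^ k] is arbitrarily large while all blocks end before [r ^ k];
   a block of [k] zeros ending at [m < r ^ k] is longer than [log_r m]. *)
Require Import Defs.
From HB Require Import structures.
From mathcomp Require Import all_boot all_order all_algebra.
From mathcomp Require Import all_classical all_reals all_analysis.
From mathcomp Require Import ring lra zify.
Import Order.TTheory GRing.Theory Num.Theory.
Import numFieldNormedType.Exports.
Local Open Scope classical_set_scope.
Local Open Scope ring_scope.

(** * Nondecreasing convex polynomials on an interval *)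

(** Convexity is the three-point chord inequality with denominators cleared, so that degenerate
    intervals cause no trouble. *)
Definition rising_convex {R : realType} (D : {poly R}) (u v : R) : Prop :=
  [/\ D.[u] = 0,
      forall x y, u <= x -> x <= y -> y <= v -> D.[x] <= D.[y] &
      forall x y z, u <= x -> x <= y -> y <= z -> z <= v ->
        (z - x) * D.[y] <= (z - y) * D.[x] + (y - x) * D.[z]].

Lemma rising_convex_sub {R : realType} (D : {poly R}) (u w v : R) :
  w <= v -> rising_convex D u v -> rising_convex D u w.
Proof.
move=> wv [D0 Dm Dc]; split=> // [x y ux xy yw|x y z ux xy yz zw].
  by apply: Dm => //; exact: le_trans yw wv.
by apply: Dc => //; exact: le_trans zw wv.
Qed.

Lemma rising_convex_subr1 {R : realType} (D : {poly R}) (u p v : R) :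
  u <= p -> D.[p] = 1 -> rising_convex D u v -> rising_convex (D - 1) p v.
Proof.
move=> up Dp [D0 Dm Dc]; split.
- by rewrite !hornerE Dp subrr.
- by move=> x y px xy yv; rewrite !hornerE lerD2r Dm // (le_trans up).
move=> x y z px xy yz zv; rewrite !hornerE.
have := Dc x y z (le_trans up px) xy yz zv; lra.
Qed.

(** Multiplying the chord inequality of [D] by [y] gives that of ['X * D] up to the term [(z - y) *
    (y - x) * (D.[z] - D.[x])], which has the right sign because [D] is nondecreasing. *)
Lemma rising_convex_mulX {R : realType} (D : {poly R}) (u v : R) :
  0 <= u -> rising_convex D u v -> rising_convex ('X * D) u v.
Proof.
move=> u0 [D0 Dm Dc].
have D_ge0 x : u <= x -> x <= v -> 0 <= D.[x] by move=> ux xv; rewrite -D0 Dm.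
split; first by rewrite !hornerE D0 mulr0.
- move=> x y ux xy yv; rewrite !hornerE ler_pM //; first exact: le_trans ux.
    by rewrite D_ge0 // (le_trans xy).
  exact: Dm.
move=> x y z ux xy yz zv; rewrite !(hornerM, hornerX).
have y0 : 0 <= y by rewrite (le_trans u0) // (le_trans ux).
have := ler_wpM2l y0 (Dc x y z ux xy yz zv).
have xz : D.[x] <= D.[z] by rewrite Dm // (le_trans xy).
have : 0 <= (z - y) * (y - x) * (D.[z] - D.[x]).
  by rewrite !mulr_ge0 // subr_ge0.
lra.
Qed.

Lemma rising_convex_mulXn {R : realType} (D : {poly R}) (u v : R) k :
  0 <= u -> rising_convex D u v -> rising_convex ('X^k * D) u v.
Proof.
move=> u0 cD; elim: k => [|k IH]; first by rewrite expr0 mul1r.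
by rewrite exprS -mulrA; exact: rising_convex_mulX.
Qed.

Lemma rising_convex_ge0 {R : realType} (D : {poly R}) (u v x : R) :
  rising_convex D u v -> u <= x -> x <= v -> 0 <= D.[x].
Proof. by move=> [<- Dm _] ux xv; exact: Dm. Qed.

(** Monotonicity gives only [<= 1]; the chord from [(u, 0)] to [(v, D.[v])] makes it strict before
    [v]. *)
Lemma rising_convex_lt1 {R : realType} (D : {poly R}) (u v x : R) :
  rising_convex D u v -> D.[v] <= 1 -> u <= x -> x < v -> D.[x] < 1.
Proof.
move=> [D0 Dm Dc] Dv ux xv.
have uv : 0 < v - u by rewrite subr_gt0 (le_lt_trans ux).
rewrite -(ltr_pM2l uv) mulr1.
have := Dc u x v (lexx _) ux (ltW xv) (lexx _); rewrite D0 mulr0 add0r.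
move/le_lt_trans; apply.
have : (x - u) * D.[v] <= (x - u) * 1 by rewrite ler_wpM2l // subr_ge0.
lra.
Qed.

Lemma rising_convex_ivt1 {R : realType} (D : {poly R}) (u v : R) :
  u <= v -> rising_convex D u v -> 1 < D.[v] ->
  exists p, [/\ u <= p, p < v & D.[p] = 1].
Proof.
move=> uv [D0 Dm Dc] Dv.
have [|p /andP[up pv] /rootP] := @poly_ivt R (D - 1) u v uv.
  by rewrite !hornerE D0 sub0r oppr_le0 ler01 subr_ge0 ltW.
rewrite !hornerE => /eqP; rewrite subr_eq0 => /eqP Dp.
exists p; split=> //; rewrite lt_neqAle pv andbT.
by apply/eqP => pE; rewrite -pE Dp ltxx in Dv.
Qed.

(** * Finite interval covers and their total length *)

Definition in_tiles {R : realType} (s : seq (R * R)) (q : R) : bool :=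
  has (fun I => I.1 <= q < I.2) s.

Definition tiles_length {R : realType} (s : seq (R * R)) : R :=
  \sum_(I <- s) (I.2 - I.1).

Lemma tiles_length_cat {R : realType} (s t : seq (R * R)) :
  tiles_length (s ++ t) = tiles_length s + tiles_length t.
Proof. by rewrite /tiles_length big_cat. Qed.

Lemma tiles_length_cons {R : realType} (I : R * R) (s : seq (R * R)) :
  tiles_length (I :: s) = I.2 - I.1 + tiles_length s.
Proof. by rewrite /tiles_length big_cons. Qed.

(** Refinements of single tiles are concatenated. [E] selects the points that must stay covered: it
    is trivial, with [c = 1], when one digit is read, and the absence of a zero block, with
    [c = 1 - b ^- k], when a block is read. *)
Lemma refine_tiles {R : realType} (A : R * R -> Prop) (E : R -> Prop) (c : R)
    (s : seq (R * R)) :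
  (forall I, I \in s -> exists t, [/\ forall J, J \in t -> A J,
     forall q, I.1 <= q < I.2 -> E q -> in_tiles t q &
     tiles_length t <= c * (I.2 - I.1)]) ->
  exists t, [/\ forall J, J \in t -> A J,
     forall q, in_tiles s q -> E q -> in_tiles t q &
     tiles_length t <= c * tiles_length s].
Proof.
elim: s => [_|I s IH H].
  by exists [::]; split=> //; rewrite /tiles_length !big_nil mulr0.
have [|t [tA tE tl]] := IH.
  by move=> J Js; apply: H; rewrite inE Js orbT.
have [|t' [t'A t'E t'l]] := H I; first exact: mem_head.
exists (t' ++ t); split.
- by move=> J; rewrite mem_cat => /orP[/t'A|/tA].
- move=> q /orP[qI|qs] Eq; rewrite /in_tiles has_cat; apply/orP.
    by left; exact: t'E.
  by right; exact: tE.
by rewrite tiles_length_cat tiles_length_cons mulrDr lerD.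
Qed.

(** * Greedy remainders and their polynomial pieces *)

(** The digits are not capped at [M], so the remainders do not depend on the alphabet;
    [beta_greedy_digit] links them to [beta] for [1 < q < M + 1]. *)
Definition greedy_rem {R : realType} (q : R) (n : nat) : R :=
  iter n (fun x => q * x - (Num.truncn (q * x))%:R) 1.

Definition greedy_digit {R : realType} (q : R) (n : nat) : nat :=
  Num.truncn (q * greedy_rem q n).

Lemma greedy_remS {R : realType} (q : R) (n : nat) :
  greedy_rem q n.+1 = q * greedy_rem q n - (greedy_digit q n)%:R.
Proof. by []. Qed.

(** The formula is restricted to the half-open piece: at [I.2] the polynomial may reach 1 while the
    remainder drops to 0. *)
Definition cylinder {R : realType} (b : R) (n : nat) (I : R * R) : Prop :=
  [/\ 1 <= I.1, I.1 <= I.2, I.2 <= b &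
    exists P : {poly R}, [/\ rising_convex P I.1 I.2, P.[I.2] <= 1 &
      forall q, I.1 <= q < I.2 -> greedy_rem q n = P.[q]]].

Lemma greedy_digit_const {R : realType} (n d : nat) (u p : R) (D : {poly R}) :
  rising_convex D u p -> D.[p] <= 1 ->
  (forall q, u <= q < p -> q * greedy_rem q n = D.[q] + d%:R) ->
  forall q, u <= q < p -> greedy_digit q n = d /\ greedy_rem q n.+1 = D.[q].
Proof.
move=> cD Dp remD q /andP[uq qp].
have Dq0 := rising_convex_ge0 _ _ _ _ cD uq (ltW qp).
have Dq1 := rising_convex_lt1 _ _ _ _ cD Dp uq qp.
have dE : greedy_digit q n = d.
  by apply: truncn_def; rewrite remD ?uq // -natr1; apply/andP; split; lra.
by rewrite greedy_remS dE remD ?uq // addrK.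
Qed.

(** Induction on [e], which bounds the number of integers still to be crossed: cut where [D] reaches
    1, and continue to the right with [D - 1] and digit [d.+1]. The leftmost piece is kept apart
    from [s] because, for [d = 0], it is where a zero block continues. *)
Lemma split_by_digit {R : realType} (b : R) (n e d : nat) (u v : R)
    (D : {poly R}) :
  1 <= u -> u <= v -> v <= b -> rising_convex D u v -> D.[v] <= e.+1%:R ->
  (forall q, u <= q < v -> q * greedy_rem q n = D.[q] + d%:R) ->
  exists p s, [/\ [/\ u <= p, p <= v, D.[p] <= 1 & p = v \/ D.[p] = 1],
    forall q, u <= q < p -> greedy_digit q n = d /\ greedy_rem q n.+1 = D.[q] &
    [/\ forall I, I \in s -> cylinder b n.+1 I,
      forall q, p <= q < v -> in_tiles s q & tiles_length s <= v - p]].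
Proof.
elim: e d u D => [|e IH] d u D u1 uv vb cD De remD;
  have [Dv|Dv] := leP D.[v] 1.
1,3: exists v, [::]; split; [by split=> //; left|exact: greedy_digit_const|].
1,2: by split=> // [q|]; [lra|rewrite /tiles_length big_nil subrr].
  by move: De; rewrite leNgt Dv.
have [p [up pv Dp]] := rising_convex_ivt1 _ _ _ uv cD Dv.
have p1 : 1 <= p by exact: le_trans up.
have cD1 := rising_convex_subr1 _ _ _ _ up Dp cD.
have [||p' [s [[pp' p'v Dp' _] hd [sc sin sl]]]] :=
    IH d.+1 p (D - 1) p1 (ltW pv) vb cD1.
- by move: De; rewrite !hornerE -natr1; lra.
- by move=> q /andP[pq qv]; rewrite remD ?(le_trans up) // !hornerE -natr1; lra.
exists p, ((p, p') :: s); split.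
- by split=> //; [exact: ltW|rewrite Dp|right].
- apply: greedy_digit_const; last first.
  - by move=> q /andP[uq qp]; apply: remD; rewrite uq (lt_trans qp).
  - by rewrite Dp.
  exact: rising_convex_sub (ltW pv) cD.
split.
- move=> I; rewrite inE => /predU1P[->|/sc //]; split=> //=.
    exact: le_trans vb.
  exists (D - 1); split=> //; first exact: rising_convex_sub cD1.
  by move=> q /hd[].
- move=> q /andP[pq qv]; rewrite /in_tiles /= pq /=.
  by have [//|p'q] := ltP q p'; apply: sin; rewrite p'q.
by rewrite tiles_length_cons /=; lra.
Qed.

Lemma cylinder_refine1 {R : realType} (b : R) (n : nat) (I : R * R) :
  cylinder b n I -> exists t, [/\ forall J, J \in t -> cylinder b n.+1 J,
     forall q, I.1 <= q < I.2 -> True -> in_tiles t q &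
     tiles_length t <= 1 * (I.2 - I.1)].
Proof.
case: I => u v [/= u1 uv vb [P [cP Pv remP]]].
have u0 : 0 <= u by exact: le_trans u1.
have cD := rising_convex_mulX _ _ _ u0 cP.
have [||p [s [[up pv Dp _] hd [sc sin sl]]]] :=
  @split_by_digit R b n (Num.truncn v) 0 u v ('X * P) u1 uv vb cD.
- rewrite !hornerE (@le_trans _ _ v) //.
    by rewrite ler_piMr // (le_trans u0).
  by apply/ltW/truncnS_gt.
- by move=> q /remP ->; rewrite hornerM hornerX addr0.
exists ((u, p) :: s); split.
- move=> J; rewrite inE => /predU1P[->|/sc //]; split=> //=.
    exact: le_trans vb.
  exists ('X * P); split=> //; first exact: rising_convex_sub cD.
  by move=> q /hd[].
- move=> q /andP[uq qv] _; rewrite /in_tiles /= uq /=.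
  by have [//|p'q] := ltP q p; apply: sin; rewrite p'q.
by rewrite tiles_length_cons /=; lra.
Qed.

Lemma cylinder_refine {R : realType} (b : R) (n : nat) (s : seq (R * R)) :
  (forall I, I \in s -> cylinder b n I) ->
  exists t, [/\ forall J, J \in t -> cylinder b n.+1 J,
     forall q, in_tiles s q -> in_tiles t q & tiles_length t <= tiles_length s].
Proof.
move=> sc; have [|t [tc tin tl]] :=
  @refine_tiles R (cylinder b n.+1) (fun=> True) 1 s.
  by move=> I /sc; exact: cylinder_refine1.
by exists t; rewrite mul1r in tl; split=> // q qs; exact: tin.
Qed.

Lemma cylinder_cover {R : realType} (b : R) (n : nat) : 1 <= b ->
  exists t, [/\ forall J, J \in t -> cylinder b n.+1 J,
     forall q, 1 <= q < b -> in_tiles t q & tiles_length t <= b - 1].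
Proof.
move=> b1; elim: n => [|n [s [sc sin sl]]]; last first.
  have [t [tc tin tl]] := cylinder_refine b n.+1 s sc.
  by exists t; split=> // [q /sin/tin//|]; exact: le_trans sl.
(* The remainder [x_0 = 1] vanishes nowhere, so the pieces start with [x_1]: on [[1, b)] the first
   digit is at least 1, and [q * x_0 = (q - 1) + 1] is split from [d = 1]. *)
have cD : rising_convex ('X - 1 : {poly R}) 1 b.
  split; first by rewrite !hornerE subrr.
    by move=> x y ? xy ?; rewrite !hornerE lerD2r.
  by move=> x y z *; rewrite !hornerE; lra.
have [||p [s [[up pv Dp _] hd [sc sin sl]]]] :=
  @split_by_digit R b 0 (Num.truncn b) 1 1 b ('X - 1) (lexx _) b1 (lexx _) cD.
- by rewrite !hornerE; have := truncnS_gt b; lra.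
- by move=> q _; rewrite /greedy_rem /= !hornerE; lra.
exists ((1, p) :: s); split.
- move=> J; rewrite inE => /predU1P[->|/sc //]; split=> //=.
  exists ('X - 1); split=> //; first exact: rising_convex_sub cD.
  by move=> q /hd[].
- move=> q /andP[uq qv]; rewrite /in_tiles /= uq /=.
  by have [//|p'q] := ltP q p; apply: sin; rewrite p'q.
by rewrite tiles_length_cons /=; lra.
Qed.

(** * Blocks of zero digits *)

Definition zero_run {R : realType} (q : R) (n k : nat) : Prop :=
  forall j, (j < k)%N -> greedy_digit q (n + j) = 0%N.

(** A zero digit only multiplies the remainder by [q], so one leftmost piece carries the zero block
    and each new digit may shorten it. The parts cut off earlier are refined at every step, so that
    all of [s] reaches order [n + k]. *)
Lemma split_zero_run {R : realType} (b : R) (n k : nat) (u v : R)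
    (P : {poly R}) :
  1 <= u -> u <= v -> v <= b -> rising_convex P u v -> P.[v] <= 1 ->
  (forall q, u <= q < v -> greedy_rem q n = P.[q]) ->
  exists p s, [/\ [/\ u <= p, p <= v & p = v \/ p ^+ k * P.[p] = 1],
    forall q, u <= q < p ->
      zero_run q n k /\ greedy_rem q (n + k) = q ^+ k * P.[q] &
    [/\ forall I, I \in s -> cylinder b (n + k) I,
      forall q, p <= q < v -> in_tiles s q & tiles_length s <= v - p]].
Proof.
move=> u1 uv vb cP Pv remP.
elim: k => [|k [p [s [[up pv pE] hd [sc sin sl]]]]].
  exists v, [::]; split; [by split=> //; left| |].
    by move=> q /remP qP; rewrite addn0 expr0 mul1r.
  by split=> // [q|]; [lra|rewrite /tiles_length big_nil; lra].
have u0 : 0 <= u by exact: le_trans u1.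
pose D : {poly R} := 'X^(k.+1) * P.
have DE x : D.[x] = x ^+ k.+1 * P.[x] by rewrite !hornerE.
have cD : rising_convex D u p.
  exact/rising_convex_mulXn/(rising_convex_sub _ _ _ _ pv).
have [||p' [s' [[up' p'p Dp' p'E] hd' [sc' sin' sl']]]] :=
  @split_by_digit R b (n + k) (Num.truncn D.[p]) 0 u p D u1 up
    (le_trans pv vb) cD.
- exact/ltW/truncnS_gt.
- by move=> q /hd[_ ->]; rewrite DE exprS mulrA addr0.
have [t [tc tin tl]] := cylinder_refine b (n + k) s sc.
exists p', (s' ++ t); split.
- split=> //; first exact: le_trans pv.
  rewrite -DE; case: p'E => [p'E|]; last by right.
  case: pE => [pE|pE]; [by left; rewrite p'E|right].
  (* An earlier cut without a new one gives [D.[p] = p >= 1], and [D.[p'] <= 1] with [p' = p] forces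
     equality. *)
  apply/eqP; rewrite eq_le Dp' DE p'E exprS -mulrA pE mulr1.
  exact: le_trans up.
- move=> q /andP[uq qp'].
  have [] := hd q; first by rewrite uq (lt_le_trans qp').
  move=> z0 _; have [] := hd' q; first by rewrite uq.
  move=> d0; rewrite addnS DE => ->; split=> // j.
  by rewrite ltnS leq_eqVlt => /predU1P[->//|]; exact: z0.
rewrite addnS; split.
- by move=> I; rewrite mem_cat => /orP[/sc'|/tc].
- move=> q /andP[p'q qv]; rewrite /in_tiles has_cat; apply/orP.
  have [qp|pq] := ltP q p; first by left; apply: sin'; rewrite p'q.
  by right; apply/tin/sin; rewrite pq.
by rewrite tiles_length_cat; lra.
Qed.

(** If [p = v], nothing is left to cover. Otherwise [P.[p] = p ^- k >= b ^- k], while the chord from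
    [(u, 0)] to [(v, P.[v])] with [P.[v] <= 1] gives [(v - u) * P.[p] <= p - u]. *)
Lemma cylinder_no_zero_run {R : realType} (b : R) (n k : nat) (I : R * R) :
  cylinder b n I ->
  exists t, [/\ forall J, J \in t -> cylinder b (n + k) J,
     forall q, I.1 <= q < I.2 -> ~ zero_run q n k -> in_tiles t q &
     tiles_length t <= (1 - b ^- k) * (I.2 - I.1)].
Proof.
case: I => u v [/= u1 uv vb [P [cP Pv remP]]].
have [p [s [[up pv pE] hd [sc sin sl]]]] :=
  @split_zero_run R b n k u v P u1 uv vb cP Pv remP.
exists s; split=> //.
  move=> q /andP[uq qv] nz; apply: sin; rewrite qv andbT leNgt.
  by apply/negP => qp; apply: nz; have [] := hd q; first by rewrite uq.
have b1 : 1 <= b by rewrite (le_trans u1) // (le_trans uv).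
have bk0 : 0 < b ^+ k by rewrite exprn_gt0 // (lt_le_trans ltr01).
have bk1 : b ^- k <= 1 by rewrite invf_le1 // exprn_ege1.
apply: (le_trans sl); case: pE => [->|pE].
  by rewrite subrr mulr_ge0 // subr_ge0.
suff : b ^- k * (v - u) <= p - u by lra.
have [P0 _ Pc] := cP.
have p0 : 0 <= p by rewrite (le_trans _ up) // (le_trans _ u1).
have Pp0 := rising_convex_ge0 _ _ _ _ cP up pv.
have Pp : b ^- k <= P.[p].
  rewrite -div1r ler_pdivrMr // -pE mulrC ler_wpM2l //.
  by rewrite lerXn2r ?nnegrE // ?(le_trans pv) // (le_trans _ b1).
have := Pc u p v (lexx _) up pv (lexx _); rewrite P0 mulr0 add0r.
have : b ^- k * (v - u) <= P.[p] * (v - u) by rewrite ler_wpM2r // subr_ge0.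
have : (p - u) * P.[v] <= (p - u) * 1 by rewrite ler_wpM2l // subr_ge0.
lra.
Qed.

Lemma no_zero_runs_cover {R : realType} (b : R) (n k L : nat) : 1 <= b ->
  exists t : seq (R * R), [/\ forall J, J \in t -> J.1 <= J.2,
     forall q, 1 <= q < b ->
       (forall i, (i < L)%N -> ~ zero_run q (n.+1 + i * k) k) -> in_tiles t q &
     tiles_length t <= (1 - b ^- k) ^+ L * (b - 1)].
Proof.
move=> b1.
have bk0 : 0 < b ^+ k by rewrite exprn_gt0 // (lt_le_trans ltr01).
have bk1 : b ^- k <= 1 by rewrite invf_le1 // exprn_ege1.
(* The induction on [L] must remember that the tiles are cylinders, since the next block is cut
   inside them. *)
suff [t [tc tin tl]] : exists t : seq (R * R),
    [/\ forall J, J \in t -> cylinder b (n.+1 + L * k) J,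
     forall q, 1 <= q < b ->
       (forall i, (i < L)%N -> ~ zero_run q (n.+1 + i * k) k) -> in_tiles t q &
     tiles_length t <= (1 - b ^- k) ^+ L * (b - 1)].
  by exists t; split=> // J /tc[].
elim: L => [|L [s [sc sin sl]]].
  have [t [tc tin tl]] := cylinder_cover b n b1.
  by exists t; rewrite addn0 mul1r; split=> // q qb _; exact: tin.
have [|t [tc tin tl]] := @refine_tiles R (cylinder b (n.+1 + L.+1 * k))
    (fun q => ~ zero_run q (n.+1 + L * k) k) (1 - b ^- k) s.
  rewrite mulSnr addnA => I /sc; exact: cylinder_no_zero_run.
exists t; split=> //.
  by move=> q qb qz; apply: tin; [apply: sin => // i /ltnW|]; exact: qz.
by rewrite (le_trans tl) // exprS -mulrA ler_wpM2l // subr_ge0.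
Qed.

(** * Choice of the block length and of the number of blocks *)

Lemma bernoulli_ineq {R : realType} (x : R) (n : nat) :
  0 <= x -> 1 + n%:R * x <= (1 + x) ^+ n.
Proof.
move=> x0; elim: n => [|n IH]; first by rewrite mul0r addr0 expr0.
have x10 : 0 <= 1 + x by lra.
have nx : 0 <= n%:R * x * x by rewrite !mulr_ge0.
by have := ler_wpM2l x10 IH; rewrite -exprS -natr1; lra.
Qed.

(** An elementary substitute for [(1 - x) ^+ n <= exp (- n x)]. The induction step rests on [(1 - x)
    (1 + (n + 1) x) = 1 + n x - (n + 1) x ^ 2]. *)
Lemma exprn_1B_le {R : realType} (x : R) (n : nat) :
  0 <= x <= 1 -> (1 - x) ^+ n * (1 + n%:R * x) <= 1.
Proof.
move=> /andP[x0 x1]; elim: n => [|n IH].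
  by rewrite expr0 mul0r addr0 mulr1.
apply: le_trans IH; rewrite exprSr -mulrA ler_wpM2l ?exprn_ge0 ?subr_ge0 //.
have nx : 0 <= n%:R * x * x by rewrite !mulr_ge0.
have xx : 0 <= x * x by rewrite mulr_ge0.
by rewrite -natr1; lra.
Qed.

(** Take [k = 2 j] and [x = rho - 1]. Squaring the Bernoulli bound [rho ^ j >= j x] gives
    [rho ^ k >= j ^ 2 x ^ 2], which exceeds [2 C j] once [j x ^ 2 > 2 C]. *)
Lemma linear_lt_expr {R : realType} (rho : R) (C : nat) :
  1 < rho -> exists2 k, (0 < k)%N & (C * k)%:R < rho ^+ k.
Proof.
move=> rho1; pose x := rho - 1; have x0 : 0 < x by rewrite subr_gt0.
have xE : 1 + x = rho by rewrite /x; lra.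
pose j := (Num.truncn ((C * 2)%:R / (x * x))).+1.
exists (j * 2)%N; first by rewrite muln_gt0.
have jC : (C * 2)%:R < j%:R * (x * x).
  by rewrite -ltr_pdivrMr ?mulr_gt0 // truncnS_gt.
have j0 : 0 < j%:R :> R by rewrite ltr0n.
rewrite exprM; apply: (@lt_le_trans _ _ ((j%:R * x) ^+ 2)); last first.
  rewrite lerXn2r ?nnegrE ?mulr_ge0 // ?ltW // ?exprn_gt0 //; first by lra.
  have := bernoulli_ineq x j (ltW x0); rewrite xE; lra.
rewrite (_ : (C * (j * 2))%N = (j * (C * 2))%N); last by lia.
by rewrite natrM expr2 mulrACA -mulrA ltr_pM2l.
Qed.

(* About [r ^ k / k] disjoint blocks of length [k] end before [r ^ k], which
   exceeds any multiple of [b ^ k]. *)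
Lemma exists_scale {R : realType} (b r eps : R) (n : nat) :
  1 <= b -> b < r -> 0 < eps ->
  exists k L : nat, (n + L * k)%:R < r ^+ k /\
    (1 - b ^- k) ^+ L * (b - 1) <= eps.
Proof.
move=> b1 br eps0.
have b0 : 0 < b by exact: lt_le_trans b1.
(* [a] is the value that [L / b ^ k] has to reach: then [(1 - b ^- k) ^+ L * a <= 1], and
   [b - 1 <= eps * a] concludes. *)
pose a := (Num.truncn ((b - 1) / eps)).+1.
have aE : b - 1 <= eps * a%:R.
  by rewrite mulrC -ler_pdivrMr // ltW // truncnS_gt.
(* The constant comes from [L <= 2 a b ^ k], whence [n + L k <= (2 a + n) k b ^ k]. *)
have [|k k0 kC] := linear_lt_expr (r / b) (a * 2 + n).
  by rewrite ltr_pdivlMr // mul1r.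
have bk0 : 0 < b ^+ k by rewrite exprn_gt0.
have bk1 : 1 <= b ^+ k by rewrite exprn_ege1.
pose L := ((Num.truncn (b ^+ k)).+1 * a)%N.
have LE : L%:R <= 2 * b ^+ k * a%:R.
  rewrite natrM ler_wpM2r // -natr1.
  by have /andP[+ _] := truncn_itv (ltW bk0); lra.
have aL : a%:R <= L%:R * b ^- k.
  rewrite ler_pdivlMr // natrM mulrC ler_wpM2r //.
  exact/ltW/truncnS_gt.
exists k, L; clearbody a L; split.
  rewrite expr_div_n ltr_pdivlMr // in kC; apply: le_lt_trans kC.
  have k1 : 1 <= k%:R :> R by rewrite ler1n.
  have nk : n%:R * 1 <= n%:R * (k%:R * b ^+ k) :> R.
    by rewrite ler_wpM2l // mulr_ege1.
  rewrite natrD !natrM natrD natrM.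
  by have := ler_wpM2r (ler0n R k) LE; lra.
set e := (1 - _) ^+ _.
have bki : 0 <= b ^- k <= 1 by rewrite invr_ge0 ltW //= invf_le1.
have e0 : 0 <= e by rewrite exprn_ge0 // subr_ge0; case/andP: bki.
have : e * (1 + L%:R * b ^- k) <= 1 by exact: exprn_1B_le.
have eaL := ler_wpM2l (ltW eps0) aL.
have := ler_wpM2l e0 (le_trans aE eaL).
move=> h1 h2; apply: (le_trans h1).
rewrite mulrCA -[leRHS]mulr1 ler_wpM2l ?(ltW eps0) //.
by apply: le_trans h2; rewrite mulrDr mulr1 lerDr.
Qed.

(** * From covers to null sets *)

Lemma in_tiles_measurable {R : realType} (t : seq (R * R)) :
  (forall J, J \in t -> J.1 <= J.2) ->
  measurable [set q : R | in_tiles t q] /\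
  (lebesgue_measure [set q : R | in_tiles t q] <= (tiles_length t)%:E)%E.
Proof.
elim: t => [_|[x y] t IH H].
  rewrite (_ : [set _ | _] = set0) ?measure0; last by apply/seteqP; split.
  by split=> //; rewrite /tiles_length big_nil.
have [mt lt] := IH (fun J Jt => H J (mem_behead (s := _ :: _) Jt)).
have xy : x <= y by exact: (H (x, y) (mem_head _ _)).
have -> : [set q | in_tiles ((x, y) :: t) q] =
    [set` `[x, y[ ] `|` [set q | in_tiles t q].
  by apply/seteqP; split=> q /=; rewrite in_itv /= => /orP.
split; first exact: measurableU.
have mI : measurable [set` `[x, y[ ] by exact: measurable_itv.
have := measureU2 (@lebesgue_measure R) mI mt; move=> /le_trans; apply.
rewrite tiles_length_cons EFinD leeD //= lebesgue_measure_itv /= lte_fin.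
by case: ifP => // _; rewrite lee_fin subr_ge0.
Qed.

(** The intersection of covers of length at most [1 / (n + 1)] is a measurable null set containing
    [E]. *)
Lemma negligible_of_covers {R : realType} (E : set R) :
  (forall eps : R, 0 < eps -> exists t : seq (R * R),
    [/\ forall J, J \in t -> J.1 <= J.2, forall q, E q -> in_tiles t q &
      tiles_length t <= eps]) ->
  (@lebesgue_measure R).-negligible E.
Proof.
move=> H.
have /choice[t tP] : forall n : nat, exists t : seq (R * R),
    [/\ forall J, J \in t -> J.1 <= J.2, forall q, E q -> in_tiles t q &
      tiles_length t <= n.+1%:R^-1].
  by move=> n; apply: H; rewrite invr_gt0 ltr0n.
pose F n := [set q | in_tiles (t n) q].
have mF n : measurable (F n) by have [/in_tiles_measurable[]] := tP n.
exists (\bigcap_n F n); split; first exact: bigcapT_measurable.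
  apply/eqP; rewrite eq_le measure_ge0 andbT; apply/lee_addgt0Pr => e e0.
  rewrite add0e; near \oo => n.
  apply: (@le_trans _ _ (lebesgue_measure (F n))).
    apply: le_measure; rewrite ?inE.
    - exact: bigcapT_measurable.
    - exact: mF.
    - exact: bigcap_inf.
  have [/in_tiles_measurable[_ le1] _ le2] := tP n.
  apply: (le_trans le1); rewrite lee_fin (le_trans le2) // ltW //.
  near: n; exact: (near_infty_natSinv_lt (PosNum e0)).
by move=> q Eq n _; have [_ + _] := tP n; exact.
Unshelve. all: by end_near. Qed.

(** * Agreement of the greedy digits with [beta] *)

Lemma greedy_rem_bound {R : realType} (q : R) (n : nat) :
  0 <= q -> 0 <= greedy_rem q n <= 1.
Proof.
move=> q0; elim: n => [|n /andP[r0 _]].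
  by rewrite /greedy_rem /= ler01 lexx.
have := truncn_itv (mulr_ge0 q0 r0).
rewrite greedy_remS /greedy_digit -natr1 => /andP[? ?].
by apply/andP; split; lra.
Qed.

(** The digit is at most [q * x_n <= q]. The bound on [q] is strict because at [q = M + 1] the
    uncapped first digit is [M + 1]. *)
Lemma greedy_digit_le {R : realType} (M : nat) (q : R) (n : nat) :
  0 <= q -> q < M%:R + 1 -> (greedy_digit q n < M.+1)%N.
Proof.
move=> q0 qM; have /andP[r0 r1] := greedy_rem_bound q n q0.
rewrite -(ltr_nat R) -[M.+1%:R]natr1; apply: le_lt_trans qM.
have /andP[+ _] := truncn_itv (mulr_ge0 q0 r0).
by move=> /le_trans; apply; rewrite ler_piMr.
Qed.

Lemma greedy_series {R : realType} (q : R) (n : nat) : q != 0 ->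
  series (fun i => (greedy_digit q i)%:R * q ^- i.+1) n =
  1 - greedy_rem q n * q ^- n.
Proof.
move=> q0; elim: n => [|n IH].
  by rewrite /series /= big_geq // expr0 invr1 mulr1 subrr.
by rewrite seriesSr IH greedy_remS exprS; field; rewrite q0 expf_neq0.
Qed.

Lemma greedy_series_cvg {R : realType} (q : R) : 1 < q ->
  series (fun i => (greedy_digit q i)%:R * q ^- i.+1) @ \oo --> (1 : R).
Proof.
move=> q1; have q0 : 0 < q by exact: lt_trans q1.
have qi : `|q^-1| < 1 by rewrite ger0_norm ?invr_ge0 ?invf_lt1 // ltW.
rewrite (_ : series _ = fun n => 1 - greedy_rem q n * q ^- n); last first.
  by apply/funext => n; rewrite greedy_series // gt_eqF.
rewrite -[X in _ --> X]subr0; apply: cvgB; first exact: cvg_cst.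
apply: (@squeeze_cvgr _ _ _ _ (cst 0) (geometric 1 q^-1)).
- near=> n; have /andP[r0 r1] := greedy_rem_bound q n (ltW q0).
  have qn : 0 <= q ^- n by rewrite invr_ge0 exprn_ge0 // ltW.
  by rewrite mulr_ge0 //= exprVn ler_wpM2r.
- exact: cvg_cst.
- exact: cvg_geometric.
Unshelve. all: by end_near. Qed.

(** The greedy digits expand 1, so maximality leaves equality or a first index [n] where [beta] is
    larger. There its digit exceeds [q * x_n], which pushes the partial sum above 1. *)
Lemma beta_greedy_digit {R : realType} (M : nat) (q : R) :
  1 < q -> q < M%:R + 1 -> forall n, beta M q n = greedy_digit q n :> nat.
Proof.
move=> q1 qM; have q0 : 0 < q by exact: lt_trans q1.
pose g n : 'I_M.+1 := inord (greedy_digit q n).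
have gE n : g n = greedy_digit q n :> nat.
  by rewrite inordK // greedy_digit_le // ltW.
have gS n : series (fun i => (g i)%:R * q ^- i.+1) n =
    1 - greedy_rem q n * q ^- n.
  by rewrite -greedy_series ?gt_eqF //; apply: eq_bigr => i _; rewrite gE.
have gexp : is_expansion q 1 g.
  rewrite /is_expansion (_ : (fun i => _) =
    fun i => (greedy_digit q i)%:R * q ^- i.+1); first exact: greedy_series_cvg.
  by apply/funext => i; rewrite gE.
have [bexp blex] := betaP q1 (ltW qM).
case: (blex g gexp) => [<- //|[n [gb gbn]]]; exfalso.
pose S := series (fun i => (beta M q i)%:R * q ^- i.+1).
have Sle : S n.+1 <= 1.
  rewrite -(cvg_lim (@Rhausdorff R) bexp); apply: nondecreasing_cvgn_le.
    apply: nondecreasing_series => i _ _.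
    by rewrite mulr_ge0 // invr_ge0 exprn_ge0 // ltW.
  by apply/cvg_ex; exists 1.
have SE : S n = 1 - greedy_rem q n * q ^- n.
  by rewrite -gS; apply: eq_big_nat => i /= /gb ->.
move: Sle; rewrite /S seriesSr -/(S n) SE; apply/negP; rewrite -ltNge.
have -> : greedy_rem q n * q ^- n = q * greedy_rem q n * q ^- n.+1.
  by rewrite exprS; field; rewrite expf_neq0 gt_eqF.
rewrite -addrA ltrDl addrC subr_gt0 ltr_pM2r ?invr_gt0 ?exprn_gt0 //.
have /andP[r0 _] := greedy_rem_bound q n (ltW q0).
have /andP[_ /lt_le_trans] := truncn_itv (mulr_ge0 (ltW q0) r0); apply.
by rewrite ler_nat -/(greedy_digit q n) -gE.
Qed.

Lemma zero_run_suffix {R : realType} (M : nat) (q : R) (n k : nat) :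
  1 < q -> q < M%:R + 1 -> zero_run q n k ->
  suffix (nseq k (ord0 : 'I_M.+1)) (mkseq (beta M q) (n + k)).
Proof.
move=> q1 qM z; rewrite /mkseq iotaD map_cat add0n.
rewrite (_ : map _ (iota n k) = nseq k ord0); first exact: suffix_suffix.
apply: (@eq_from_nth _ ord0); first by rewrite size_map size_iota size_nseq.
move=> i; rewrite size_map size_iota => ik.
rewrite (nth_map 0%N) ?size_iota // nth_iota // nth_nseq ik.
by apply: val_inj; rewrite /= beta_greedy_digit // z.
Qed.

Theorem theorem1p5 (R : realType) (M : nat) (r : R)
    (hM : (1 <= M)%N) (hr1 : 1 < r) (hrM : r <= M%:R + 1) :
  {ae (@lebesgue_measure R), forall q : R, q \in `]1, r[ ->
    forall N : nat, exists m : nat, (N < m)%N /\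
      exists k : nat,
        suffix (nseq k (ord0 : 'I_M.+1)) (mkseq (beta M q) m) /\
        logb r m%:R < k%:R}.
Proof.
pose good (q : R) N := exists m : nat, (N < m)%N /\ exists k : nat,
  suffix (nseq k (ord0 : 'I_M.+1)) (mkseq (beta M q) m) /\ logb r m%:R < k%:R.
(* The length estimate needs [b < r], so [(1, r)] is exhausted by the intervals [(1, b j)]; the
   exceptional set is then a countable union over [j] and [N]. *)
pose b j : R := r - j.+1%:R^-1.
pose E j N := [set q : R | 1 < q < b j /\ ~ good q N].
suff EN j N : (@lebesgue_measure R).-negligible (E j N).
  have : (@lebesgue_measure R).-negligible (\bigcup_j \bigcup_N E j N).
    by apply: negligible_bigcup => j; exact: negligible_bigcup.
  rewrite /prop_near1 /nbhs /= /almost_everywhere; apply: negligibleS.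
  move=> q /= /not_implyP[]; rewrite in_itv /= => /andP[q1 qr] /existsNP[N qN].
  near \oo => j; exists j => //; exists N => //; split=> //; rewrite q1 /b /=.
  rewrite ltrBrDl -ltrBrDr; near: j.
  have rq : 0 < r - q by rewrite subr_gt0.
  exact: (near_infty_natSinv_lt (PosNum rq)).
apply: negligible_of_covers => eps eps0.
have br : b j < r by rewrite /b ltrBlDr ltrDl invr_gt0 ltr0n.
(* For small [j] the endpoint [b j] may lie below 1, and then [E j N] is empty. *)
have [b1|b1] := ltP (b j) 1.
  exists [::]; split=> //; last by rewrite /tiles_length big_nil ltW.
  move=> q [/andP[q1 qb] _].
  by have := lt_trans q1 (lt_trans qb b1); rewrite ltxx.
have [k [L [Lk Le]]] := exists_scale (b j) r eps N.+1 b1 br eps0.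
have [t [tle tin tl]] := no_zero_runs_cover (b j) N k L b1.
exists t; split=> //; last exact: le_trans Le.
move=> q [/andP[q1 qb] qN]; apply: tin => [|i iL z]; first by rewrite ltW.
(* A zero block with index [i < L] ends at [m = N + 1 + (i + 1) k <= N + 1 + L k < r ^ k], so
   [log_r m < k]; starting the blocks at [N + 1] gives [m > N]. *)
apply: qN; exists (N.+1 + i * k + k)%N; split; first by lia.
have qM : q < M%:R + 1 by rewrite (lt_trans qb) // (lt_le_trans br).
exists k; split; first exact: zero_run_suffix.
have r0 : 0 < r by exact: lt_trans hr1.
rewrite /logb ltr_pdivrMr ?ln_gt0 // mulr_natl -lnXn //.
rewrite ltr_ln ?posrE ?exprn_gt0 ?ltr0n //.
apply: le_lt_trans Lk; rewrite ler_nat -addnA leq_add2l.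
by rewrite addnC -mulSn leq_mul2r iL orbT.
Unshelve. all: by end_near. Qed.
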